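(* There exists a universal constant $c_0>0$ such that the following holds. Let $n\ge 2$, let $0<\tau_1\le\dots\le\tau_n$ be the computation times of the workers in the fixed computation model, and consider any randomized method. Fix any $\varepsilon,L_{\max},R,\mu,\sigma^2>0$ such that $\mu<L_{\max}/(2n)$, $\varepsilon<0.01$ and $R>10$. For any time budget $$t\le c_0\left(\frac1n\sum_{i=1}^n\tau_i\right)\frac{\sigma^2}{\varepsilon n\mu^2}$$ there exist a dimension $d$, functions $f_1,\dots,f_n:\mathbb{R}^d\to\mathbb{R}$ with average $f=\frac1n\sum_{i=1}^n f_i$, stochastic gradients $\nabla f_i(\cdot;\cdot)$, and a starting point $x^0$ at distance at most $R$ from the closest minimizer of $f$, such that: (1) every $f_i$ is differentiable, $L_{\max}$-smooth and convex, and $f$ attains its minimum; (2) (weak interpolation) every minimizer of $f$ is a minimizer of each $f_i$, $i\in[n]$; (3) (local Polyak-Łojasiewicz condition) every $f_i$, $i\in[n]$, satisfies the Polyak-Łojasiewicz condition with parameter $\mu$; (4) $f$ is $L_{\max}$-smooth and satisfies the Polyak-Łojasiewicz condition with parameter $\mu$; (5) the stochastic gradients are unbiased and $\sigma^2$-variance-bounded; (6) the method started at $x^0$ cannot find an $\varepsilon$-solution in terms of distances to the solution set within $t$ seconds, i.e., every (random) point $\bar x$ it produces within $t$ seconds satisfies $\mathbb{E}\left[\|\bar x-\bar x_*\|^2\right]>\varepsilon$, where $\bar x_*$ is the minimizer of $f$ closest to $\bar x$. (It is not required that, conversely, every minimizer of $f_i$ is a minimizer of $f$.)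
   Context: $[n]=\{1,\dots,n\}$; $\|\cdot\|$ is the Euclidean norm. A function $g$ is $L$-smooth if $\|\nabla g(x)-\nabla g(y)\|\le L\|x-y\|$ for all $x,y$. Distributed setting: there are $n$ workers operating in parallel and asynchronously; worker $i$ has access only to stochastic gradients $\nabla f_i(x;\xi_i)$, $\xi_i\sim\mathcal{D}_i$, of $f_i$, each returned stochastic gradient using a fresh independent sample. Fixed computation model: worker $i$ computes one stochastic gradient at a time and each computation takes $\tau_i$ seconds, so by time $t$ worker $i$ has returned at most $\lfloor t/\tau_i\rfloor$ stochastic gradients. Randomized method: any procedure that, given a starting point, using its own internal randomness (independent of the gradient noise) and the stochastic gradients returned so far, adaptively decides at which points the workers compute stochastic gradients, and which outputs (random) points depending only on this information. A point is produced within $t$ seconds if it depends only on the internal randomness and on stochastic gradients returned by time $t$. Unbiased, $\sigma^2$-variance-bounded: $\mathbb{E}_{\xi_i}[\nabla f_i(x;\xi_i)]=\nabla f_i(x)$ and $\mathbb{E}_{\xi_i}[\|\nabla f_i(x;\xi_i)-\nabla f_i(x)\|^2]\le\sigma^2$ for all $x\in\mathbb{R}^d$, $i\in[n]$. Polyak-Łojasiewicz condition with parameter $\mu>0$ for a function $g$: $\|\nabla g(x)\|^2\ge 2\mu(g(x)-g^* )$ for all $x\in\mathbb{R}^d$, where $g^*$ is the finite optimal value of $g$. *)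

(* Defs.v *)
From HB Require Import structures.
From mathcomp Require Import all_boot all_order all_algebra.
From mathcomp Require Import all_classical all_reals all_analysis.

Set Implicit Arguments.
Unset Strict Implicit.
Unset Printing Implicit Defensive.

Import Order.TTheory GRing.Theory Num.Theory.
Import numFieldNormedType.Exports.

Local Open Scope classical_set_scope.
Local Open Scope ring_scope.

(* The library norm on row vectors is the sup norm, hence a separate one. *)
Definition enorm (R : realType) (d : nat) (x : 'rV[R]_d) : R :=
  Num.sqrt (\sum_(j < d) x 0 j ^+ 2).

Definition grad (R : realType) (d : nat) (f : 'rV[R]_d -> R) (x : 'rV[R]_d) :
    'rV[R]_d :=
  \row_j 'D_(delta_mx 0 j) (f : 'rV[R]_d -> R^o) x.

Definition differentiable_everywhere (R : realType) (d : nat)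
    (f : 'rV[R]_d -> R) : Prop :=
  forall x, differentiable (f : 'rV[R]_d -> R^o) x.

Definition smooth (R : realType) (d : nat) (L : R) (f : 'rV[R]_d -> R) : Prop :=
  differentiable_everywhere f /\
  forall x y, enorm (grad f x - grad f y) <= L * enorm (x - y).

Definition convex_everywhere (R : realType) (d : nat) (f : 'rV[R]_d -> R) :
    Prop :=
  convex_function [set: 'rV[R]_d] (f : 'rV[R]_d -> R^o).

Definition PL (R : realType) (d : nat) (mu : R) (f : 'rV[R]_d -> R) : Prop :=
  has_lbound (range f) /\
  forall x, 2 * mu * (f x - inf (range f)) <= enorm (grad f x) ^+ 2.

Definition minimizer (R : realType) (d : nat) (f : 'rV[R]_d -> R)
    (x : 'rV[R]_d) : Prop :=
  forall y, f x <= f y.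

Definition closest_minimizer (R : realType) (d : nat) (f : 'rV[R]_d -> R)
    (x p : 'rV[R]_d) : Prop :=
  minimizer f p /\ forall q, minimizer f q -> enorm (x - p) <= enorm (x - q).

Definition average (R : realType) (n d : nat) (f : 'I_n -> 'rV[R]_d -> R) :
    'rV[R]_d -> R :=
  fun x => n%:R^-1 * \sum_(i < n) f i x.

Definition random_vector (R : realType) (d : nat) (dT : measure_display)
    (T : measurableType dT) (X : T -> 'rV[R]_d) : Prop :=
  forall j, measurable_fun [set: T] (fun w => X w 0 j).

Record request (R : realType) (n d : nat) := Request {
  req_time : R;
  req_worker : 'I_n;
  req_point : 'rV[R]_d
}.

Definition random_request (R : realType) (n d : nat) (dT : measure_display)
    (T : measurableType dT) (q : T -> request R n d) : Prop :=
  [/\ measurable_fun [set: T] (fun w => req_time (q w)),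
      (forall i, measurable [set w | req_worker (q w) = i]) &
      random_vector (fun w => req_point (q w))].

(* The stochastic gradients returned so far, oldest first, each with the worker
   that computed it. *)
Definition history (R : realType) (n d : nat) := seq ('I_n * 'rV[R]_d).

(* A randomized method in dimension d.  Given the starting point, the value of
   its internal randomness, the number of requests already made and the returned
   gradients, [query] makes the next request to a worker; given the first two
   and the returned gradients, [output] is the point the method produces.
   [output] sees neither the clock nor the number of requests: it is revised
   only when new information arrives.  A method allowed to output unboundedly
   many points on the same information could enumerate a dense set, and no
   lower bound valid for every point that it produces could hold.
   Measurability, here joint in the seed and the gradients for each sequence of
   workers, is phrased as preservation of random variables. *)
Record randomized_method (R : realType) (n d : nat) := RandomizedMethod {
  seed_display : measure_display;
  seed : measurableType seed_display;
  seed_law : probability seed R;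
  query : 'rV[R]_d -> seed -> nat -> history R n d -> request R n d;
  output : 'rV[R]_d -> seed -> history R n d -> 'rV[R]_d;
  query_measurable : forall (dT : measure_display) (T : measurableType dT)
      (z : T -> seed) (G : seq ('I_n * (T -> 'rV[R]_d)))
      (x0 : 'rV[R]_d) (k : nat),
    measurable_fun [set: T] z ->
    (forall l : 'I_(size G), random_vector (tnth (in_tuple G) l).2) ->
    random_request (fun w => query x0 (z w) k [seq (p.1, p.2 w) | p <- G]);
  output_measurable : forall (dT : measure_display) (T : measurableType dT)
      (z : T -> seed) (G : seq ('I_n * (T -> 'rV[R]_d))) (x0 : 'rV[R]_d),
    measurable_fun [set: T] z ->
    (forall l : 'I_(size G), random_vector (tnth (in_tuple G) l).2) ->
    random_vector (fun w => output x0 (z w) [seq (p.1, p.2 w) | p <- G])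
}.

(* [job i] is the starting time and the point of the computation of worker i
   that has not been collected yet, if any. *)
Record state (R : realType) (n d : nat) := State {
  clock : R;
  job : 'I_n -> option (R * 'rV[R]_d);
  returned : history R n d
}.

(* Worker i is contacted at time s.  If its computation is finished, that is,
   was started at least tau i seconds earlier, it returns the stochastic
   gradient at the point of its job, on the next unused sample of its stream,
   and becomes idle.  Otherwise it starts a computation at the requested point,
   abandoning its unfinished computation if there is one.  The method chooses
   the times, so it may contact a worker exactly when it finishes, and may
   restart it at that same instant.  Requests in the past are executed now. *)
Definition step (R : realType) (n d : nat) (tau : 'I_n -> R)
    (Sample : Type) (g : 'I_n -> 'rV[R]_d -> Sample -> 'rV[R]_d)
    (xi : 'I_n -> nat -> Sample) (q : request R n d) (st : state R n d) :
    state R n d :=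
  let s := Num.max (clock st) (req_time q) in
  let i := req_worker q in
  let start := State s [eta job st with i |-> Some (s, req_point q)]
                     (returned st) in
  match job st i with
  | Some (s0, y) =>
      if s0 + tau i <= s then
        let c := count (fun p => p.1 == i) (returned st) in
        State s [eta job st with i |-> None]
              (rcons (returned st) (i, g i y (xi i c)))
      else start
  | None => start
  end.

Fixpoint run (R : realType) (n d : nat) (tau : 'I_n -> R)
    (M : randomized_method R n d) (x0 : 'rV[R]_d)
    (Sample : Type) (g : 'I_n -> 'rV[R]_d -> Sample -> 'rV[R]_d)
    (z : seed M) (xi : 'I_n -> nat -> Sample) (k : nat) : state R n d :=
  if k is k'.+1 then
    let st := run tau x0 g z xi k' in
    step tau g xi (query x0 z k' (returned st)) st
  else State 0 (fun=> None) [::].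

(* The last state with clock at most t among the first k requests. *)
Fixpoint run_within (R : realType) (n d : nat) (tau : 'I_n -> R)
    (M : randomized_method R n d) (x0 : 'rV[R]_d)
    (Sample : Type) (g : 'I_n -> 'rV[R]_d -> Sample -> 'rV[R]_d)
    (z : seed M) (xi : 'I_n -> nat -> Sample) (t : R) (k : nat) :
    state R n d :=
  let st := run tau x0 g z xi k in
  if k is k'.+1 then
    if clock st <= t then st else run_within tau x0 g z xi t k'
  else st.

(* As k ranges over nat, these are all the points produced within t seconds. *)
Definition produced_point (R : realType) (n d : nat) (tau : 'I_n -> R)
    (M : randomized_method R n d) (x0 : 'rV[R]_d)
    (Sample : Type) (g : 'I_n -> 'rV[R]_d -> Sample -> 'rV[R]_d)
    (z : seed M) (xi : 'I_n -> nat -> Sample) (t : R) (k : nat) : 'rV[R]_d :=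
  output x0 z (returned (run_within tau x0 g z xi t k)).

Definition jointly_measurable (R : realType) (d : nat) (dS : measure_display)
    (Sample : measurableType dS) (g : 'rV[R]_d -> Sample -> 'rV[R]_d) : Prop :=
  forall (dT : measure_display) (T : measurableType dT)
    (X : T -> 'rV[R]_d) (s : T -> Sample),
    random_vector X -> measurable_fun [set: T] s ->
    random_vector (fun w => g (X w) (s w)).

Definition unbiased (R : realType) (d : nat) (dS : measure_display)
    (Sample : measurableType dS) (D : probability Sample R)
    (f : 'rV[R]_d -> R) (g : 'rV[R]_d -> Sample -> 'rV[R]_d) : Prop :=
  forall x j,
    D.-integrable [set: Sample] (fun s => (g x s 0%R j)%:E) /\
    'E_D[(fun s => g x s 0%R j)]%E = (grad f x 0%R j)%:E.

Definition variance_bounded (R : realType) (d : nat) (dS : measure_display)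
    (Sample : measurableType dS) (D : probability Sample R) (sigma2 : R)
    (f : 'rV[R]_d -> R) (g : 'rV[R]_d -> Sample -> 'rV[R]_d) : Prop :=
  forall x, ('E_D[(fun s => enorm (g x s - grad f x) ^+ 2)%R] <= sigma2%:E)%E.

(* On the probability space Omega, zeta has law Q, each xi i k has law D i, and
   all these random variables are mutually independent. *)
Definition independent_with_laws (R : realType) (n : nat)
    (dO dZ dS : measure_display) (Omega : measurableType dO)
    (Z : measurableType dZ) (Sample : measurableType dS)
    (P : probability Omega R) (Q : probability Z R)
    (D : 'I_n -> probability Sample R)
    (zeta : Omega -> Z) (xi : 'I_n -> nat -> Omega -> Sample) : Prop :=
  [/\ measurable_fun [set: Omega] zeta,
      (forall i k, measurable_fun [set: Omega] (xi i k)) &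
      forall (K : nat) (A : set Z) (B : 'I_n -> nat -> set Sample),
        measurable A -> (forall i k, measurable (B i k)) ->
        P [set w | A (zeta w) /\
                   forall (i : 'I_n) (k : 'I_K), B i k (xi i k w)] =
        (Q A * \big[*%E/1]_(i < n) \big[*%E/1]_(k < K) D i (B i k))%E].

(* Main.v *)
(* Worker i alone holds the block x^(i) of the variable, with
     f_i(x) = (n mu / 2) ||x^(i) - s_i e_(theta_i)||^2,
   where s_i^2 is proportional to tau_i and sum_i s_i^2 = 4 eps, so that f is
   (mu / 2) ||x - a||^2.  With probability q_i = min(1, (n mu s_i)^2 / sigma2)
   the oracle reveals theta_i, rescaled to be unbiased, and else says nothing
   about it.  Within t seconds worker i answers at most t / tau_i times, and
   q_i t / tau_i <= 1/4, so with probability at least 3/4 it reveals nothing.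
   Then the run does not depend on theta_i, and the method shows boundedly many
   points; each of them is close to the target for at most one value of theta_i.
   If the dimension m of the blocks is large, some theta is guessed on any given
   block with probability at most 1/8, hence block i contributes at least
   (5/8) (s_i^2 / 2) to the expected squared distance, and these contributions
   sum to 5 eps / 4. *)
Require Import Defs.
From HB Require Import structures.
From mathcomp Require Import all_boot all_order all_algebra.
From mathcomp Require Import all_classical all_reals all_analysis.
From mathcomp Require Import measurable_realfun ring lra.
Set Implicit Arguments.
Unset Strict Implicit.
Unset Printing Implicit Defensive.
Import Order.TTheory GRing.Theory Num.Theory.
Import numFieldNormedType.Exports.
Local Open Scope classical_set_scope.
Local Open Scope ring_scope.

(** * Quadratic functions *)

Lemma sqr_enorm (R : realType) (d : nat) (x : 'rV[R]_d) :
  enorm x ^+ 2 = \sum_(j < d) x 0 j ^+ 2.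
Proof. by rewrite sqr_sqrtr// sumr_ge0// => j _; exact: sqr_ge0. Qed.

Lemma enorm_ge0 (R : realType) (d : nat) (x : 'rV[R]_d) : 0 <= enorm x.
Proof. exact: sqrtr_ge0. Qed.

Section quadratic.
Variables (R : realType) (d : nat) (w a : 'I_d -> R).
Implicit Types x y : 'rV[R]_d.

Definition quadratic x : R := \sum_(j < d) w j * (x 0 j - a j) ^+ 2.

Lemma quadraticE :
  quadratic = \sum_(j < d) (fun x : 'rV[R]_d => w j * (x 0 j - a j) ^+ 2 : R^o).
Proof. by apply/funext => x; rewrite fct_sumE. Qed.

Lemma differentiable_quadratic_term x j :
  differentiable (fun y : 'rV[R]_d => w j * (y 0 j - a j) ^+ 2 : R^o) x.
Proof.
have dc : differentiable (fun y : 'rV[R]_d => y 0 j - a j : R) x.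
  apply: differentiableB; first exact: differentiable_coord.
  exact: differentiable_cst.
have := differentiableZ (w j) (differentiableX 1 dc).
suff -> : (fun y : 'rV[R]_d => w j * (y 0 j - a j) ^+ 2 : R^o) =
  w j *: ((fun y : 'rV[R]_d => y 0 j - a j : R) ^+ 2) by [].
by apply/funext => y; rewrite -[LHS]/(w j *: _) exprfctE.
Qed.

Lemma differentiable_quadratic : differentiable_everywhere quadratic.
Proof.
move=> x; rewrite quadraticE; apply: differentiable_sum => j.
exact: differentiable_quadratic_term.
Qed.

Lemma grad_quadratic x : grad quadratic x = \row_j (2 * w j * (x 0 j - a j)).
Proof.
apply/rowP => j; rewrite !mxE quadraticE.
rewrite derive_sum; last first.
  by move=> i; apply: diff_derivable; exact: differentiable_quadratic_term.
rewrite (bigD1 j)//= big1 ?addr0; last first.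
  move=> i ij; rewrite /derive.
  rewrite (_ : (fun h => _) = fun=> 0); first exact: lim_cst.
  apply/funext => h /=.
  rewrite !mxE (negbTE ij) andbF mulr0 add0r subrr scaler0. done.
rewrite /derive; apply: cvg_lim => //.
have : (fun h : R => w j * (2 * (x 0 j - a j) + h)) @ 0^' -->
    w j * (2 * (x 0 j - a j) + 0).
  apply: cvgMl_tmp; apply: cvgD; first exact: cvg_cst.
  by apply: cvg_within_filter; exact: cvg_id.
rewrite addr0 mulrCA mulrA.
apply: cvg_trans; apply: near_eq_cvg; near=> h.
have h0 : h != 0 by near: h; exact: nbhs_dnbhs_neq.
rewrite /= !mxE !eqxx mulr1 /GRing.scale/=.
by field.
Unshelve. all: by end_near. Qed.

Lemma smooth_quadratic L : (forall j, 0 <= 2 * w j <= L) -> smooth L quadratic.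
Proof.
move=> wL; split; first exact: differentiable_quadratic.
move=> x y.
(* In dimension 0 the hypothesis does not force [0 <= L], but both norms are then empty sums. *)
case: (pselect (exists j : 'I_d, True)) => [[j0 _]|nd]; last first.
  rewrite /enorm !big1 ?sqrtr0 ?mulr0//;
    by move=> j _; exfalso; apply: nd; exists j.
have L0 : 0 <= L by have /andP[] := wL j0; exact: le_trans.
rewrite -(@ler_pXn2r _ 2)// ?nnegrE ?mulr_ge0 ?enorm_ge0//.
rewrite exprMn !sqr_enorm mulr_sumr ler_sum// => j _.
rewrite !grad_quadratic !mxE.
have -> : 2 * w j * (x 0 j - a j) - 2 * w j * (y 0 j - a j) =
  2 * w j * (x 0 j - y 0 j) by ring.
have /andP[w0 wl] := wL j.
by rewrite exprMn ler_wpM2r ?sqr_ge0// ler_pXn2r ?nnegrE.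
Qed.

Hypothesis w0 : forall j, 0 <= w j.

Lemma convex_quadratic : convex_everywhere quadratic.
Proof.
move=> t x y _ _; rewrite convRE !mulr_sumr -big_split/=.
apply: ler_sum => j _; rewrite !mxE/=.
have t0 : 0 <= t%:num by [].
have t1 : 0 <= 1 - t%:num by rewrite subr_ge0.
set p := t%:num in t0 t1 *.
rewrite -[unstable.onem p]/(1 - p) -subr_ge0.
have -> : p * (w j * (x 0 j - a j) ^+ 2) +
    (1 - p) * (w j * (y 0 j - a j) ^+ 2) -
    w j * (p * x 0 j + (1 - p) * y 0 j - a j) ^+ 2 =
    w j * (p * (1 - p) * (x 0 j - y 0 j) ^+ 2) by ring.
apply: mulr_ge0 => //; apply: mulr_ge0; last exact: sqr_ge0.
exact: mulr_ge0.
Qed.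

Lemma quadratic_ge0 x : 0 <= quadratic x.
Proof. by apply: sumr_ge0 => j _; rewrite mulr_ge0 ?sqr_ge0. Qed.

Lemma quadratic_center x : (forall j, x 0 j = a j) -> quadratic x = 0.
Proof. by move=> xa; apply: big1 => j _; rewrite xa subrr expr0n mulr0. Qed.

Lemma minimizer_quadratic x : (forall j, x 0 j = a j) -> minimizer quadratic x.
Proof. by move=> xa y; rewrite quadratic_center ?quadratic_ge0. Qed.

(** Coordinatewise this is [2 * mu * w j <= (2 * w j) ^+ 2]. The value [w j = 0] has to be allowed,
    because a worker's function ignores the blocks of the others. *)
Lemma PL_quadratic mu :
  (forall j, w j = 0 \/ mu <= 2 * w j) -> PL mu quadratic.
Proof.
move=> wmu; split; first by exists 0 => _ [x _ <-]; exact: quadratic_ge0.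
have -> : inf (range quadratic) = 0.
  apply/le_anti/andP; split; last first.
    apply: lb_le_inf; first by exists (quadratic 0); exists 0.
    by move=> _ [x _ <-]; exact: quadratic_ge0.
  apply: ge_inf; first by exists 0 => _ [x _ <-]; exact: quadratic_ge0.
  by exists (\row_j a j) => //; rewrite quadratic_center// => j; rewrite mxE.
move=> x; rewrite subr0 sqr_enorm mulr_sumr ler_sum// => j _.
rewrite grad_quadratic mxE mulrA exprMn.
rewrite ler_wpM2r ?sqr_ge0//.
case: (wmu j) => [->|h]; first by rewrite !mulr0 expr0n.
have := w0 j; nra.
Qed.

End quadratic.

Lemma minimizer_quadratic_uniq (R : realType) (d : nat) (w a : 'I_d -> R)
    (x : 'rV[R]_d) :
  (forall j, 0 < w j) -> minimizer (quadratic w a) x -> x = \row_j a j.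
Proof.
move=> w0 /(_ (\row_j a j)); rewrite [leRHS]quadratic_center; last first.
  by move=> j; rewrite mxE.
move=> q0; apply/rowP => j; rewrite mxE; apply/eqP; rewrite -subr_eq0.
rewrite -sqrf_eq0 -(inj_eq (mulfI (lt0r_neq0 (w0 j)))) mulr0.
have w0' i : 0 <= w i * (x 0 i - a i) ^+ 2 by rewrite mulr_ge0 ?sqr_ge0// ltW.
move: q0; rewrite /quadratic (bigD1 j)//= => q0.
rewrite eq_le w0' andbT; apply: le_trans q0.
by rewrite lerDl sumr_ge0.
Qed.

(** * Runs of a method *)

Section execution.
Variables (R : realType) (n d : nat) (tau : 'I_n -> R).
Variables (Sample : Type) (g : 'I_n -> 'rV[R]_d -> Sample -> 'rV[R]_d).
Variables (xi : 'I_n -> nat -> Sample).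

Lemma clock_step q st :
  clock (step tau g xi q st) = Num.max (clock st) (req_time q).
Proof. by rewrite /step; case: job => [[s y]|]//; case: ifP. Qed.

Lemma prefix_returned_step q st :
  prefix (returned st) (returned (step tau g xi q st)).
Proof.
rewrite /step; case: job => [[s y]|]/=; last exact: prefix_refl.
by case: ifP => _ /=; [exact: prefix_rcons|exact: prefix_refl].
Qed.

Variables (M : randomized_method R n d) (x0 : 'rV[R]_d) (z : seed M).
Notation run := (run tau x0 g z).

Lemma prefix_returned_run k l : (k <= l)%N ->
  prefix (returned (run xi k)) (returned (run xi l)).
Proof.
move=> /subnK <-; elim: (l - k)%N => [|m ih]; first exact: prefix_refl.
exact: prefix_trans ih (prefix_returned_step _ _).
Qed.

(** The initial state is kept even if [t] is negative, hence the alternative [l = 0]. *)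
Lemma run_withinP t k : exists2 l,
  run_within tau x0 g z xi t k = run xi l & l = 0 \/ clock (run xi l) <= t.
Proof.
elim: k => [|k [l e h]]; first by exists 0 => //; left.
rewrite [run_within _ _ _ _ _ _ _]/=; case: ifP => [c|_]; last by exists l.
by exists k.+1 => //; right.
Qed.

(** The history only grows along a run, so its length determines it. This later bounds how many
    different points one run can produce. *)
Lemma eq_returned_run_within t k l :
  size (returned (run_within tau x0 g z xi t k)) =
  size (returned (run_within tau x0 g z xi t l)) ->
  returned (run_within tau x0 g z xi t k) =
  returned (run_within tau x0 g z xi t l).
Proof.
have [k' -> _] := run_withinP t k; have [l' -> _] := run_withinP t l.
wlog kl : k' l' / (k' <= l')%N => [H e|].
  by case/orP: (leq_total k' l') => h; [exact: H|exact/esym/H].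
have /prefixP[s ->] := prefix_returned_run kl; rewrite size_cat => /eqP.
rewrite -[X in X == _]addn0 eqn_add2l eq_sym size_eq0 => /eqP ->.
by rewrite cats0.
Qed.

Definition answers (i : 'I_n) (h : history R n d) : nat :=
  count (fun p => p.1 == i) h.

Lemma size_history (h : history R n d) :
  size h = (\sum_(i < n) answers i h)%N.
Proof.
elim: h => [|p h ih]; first by rewrite big1.
rewrite /= big_split/= -/(answers _ _) -ih (bigD1 p.1)//= eqxx big1// => i.
by rewrite eq_sym => /negbTE ->.
Qed.

(** For an idle worker, the earliest time at which it could start again. *)
Definition busy_since (st : state R n d) i :=
  if job st i is Some (s, _) then s else clock st.

(* Each returned gradient of worker i accounts for tau i seconds before the
   start of the current computation. *)
Lemma busy_since_run k i :
  (answers i (returned (run xi k)))%:R * tau i <= busy_since (run xi k) i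
    <= clock (run xi k).
Proof.
rewrite /busy_since; elim: k i => [|k ih] i /=; first by rewrite mul0r lexx.
move: (query _ _ _ _) => q; move: (run xi k) ih => st ih; rewrite /step.
set s := Num.max _ _.
have cs : clock st <= s by rewrite le_max lexx.
have [-> | iq] := eqVneq i (req_worker q).
  have := ih (req_worker q); case: (job st (req_worker q)) => [[s0 y]|].
    case: ifP => [s0s|_] /=; rewrite ?eqxx => /andP[h1 h2].
      rewrite lexx andbT /answers -cats1 count_cat/= eqxx addn0 addn1 -natr1.
      by rewrite mulrDl mul1r (le_trans _ s0s)// lerD2r.
    by rewrite lexx andbT (le_trans (le_trans h1 h2)).
  by move=> /andP[h1 _] /=; rewrite eqxx lexx andbT (le_trans h1 cs).
(* A worker that is not contacted keeps its job and its count; only the clock advances. *)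
have := ih i; case: (job st (req_worker q)) => [[s0 y]|].
  case: ifP => [s0s|_] /=; rewrite (negbTE iq).
    rewrite /answers -cats1 count_cat/= eq_sym (negbTE iq) !addn0.
    case: (job st i) => [[s1 y1]|] /= /andP[h1 h2].
      by rewrite h1 (le_trans h2).
    by rewrite lexx andbT (le_trans h1).
  case: (job st i) => [[s1 y1]|] /= /andP[h1 h2].
    by rewrite h1 (le_trans h2).
  by rewrite lexx andbT (le_trans h1).
rewrite /= (negbTE iq); case: (job st i) => [[s1 y1]|] /= /andP[h1 h2].
  by rewrite h1 (le_trans h2).
by rewrite lexx andbT (le_trans h1).
Qed.

Hypothesis tau_gt0 : forall i, 0 < tau i.

Lemma le_answers_run t k i : clock (run xi k) <= t ->
  (answers i (returned (run xi k)) <= Num.truncn (t / tau i))%N.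
Proof.
move=> kt; have /andP[h1 h2] := busy_since_run k i.
have h : (answers i (returned (run xi k)))%:R * tau i <= t.
  exact: le_trans h1 (le_trans h2 kt).
rewrite truncn_ge_nat ?ler_pdivlMr//.
by rewrite mul0r (le_trans _ h)// mulr_ge0// ltW.
Qed.

Lemma le_size_returned_run_within t k :
  (size (returned (run_within tau x0 g z xi t k)) <=
   \sum_(i < n) Num.truncn (t / tau i))%N.
Proof.
have [l -> [->//|lt]] := run_withinP t k.
by rewrite size_history leq_sum// => i _; exact: le_answers_run.
Qed.

Lemma eq_run t (xi' : 'I_n -> nat -> Sample) k :
  (forall i l, (l < Num.truncn (t / tau i))%N -> xi i l = xi' i l) ->
  clock (run xi k) <= t -> run xi k = run xi' k.
Proof.
move=> xixi'; elim: k => //= k ih ct.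
have ckt : clock (run xi k) <= t.
  by apply: le_trans ct; rewrite clock_step le_max lexx.
rewrite -ih//.
(* The index of the sample used in this step is the count before it, hence strictly below the count
   after it, which the time budget bounds. *)
have := @le_answers_run t k.+1
  (req_worker (query x0 z k (returned (run xi k)))) ct.
rewrite /= /step; case: job => [[s y]|]//; case: ifP => // _ /=.
by rewrite /answers -cats1 count_cat/= eqxx addn1 => /xixi' ->; rewrite cats1.
Qed.

End execution.

(** * Runs under a change of samples or of oracle *)

Section execution_ext.
Variables (R : realType) (n d : nat) (tau : 'I_n -> R).
Variables (M : randomized_method R n d) (x0 : 'rV[R]_d) (z : seed M).
Variables (Sample : Type).

Lemma eq_produced_point (g : 'I_n -> 'rV[R]_d -> Sample -> 'rV[R]_d)
    (xi xi' : 'I_n -> nat -> Sample) t k :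
  (forall i, 0 < tau i) ->
  (forall i l, (l < Num.truncn (t / tau i))%N -> xi i l = xi' i l) ->
  produced_point tau x0 g z xi t k = produced_point tau x0 g z xi' t k.
Proof.
move=> tau0 xixi'; rewrite /produced_point; congr (output _ _ (returned _)).
(* [eq_run] assumes the clock bound for its first stream, so both directions serve to show that the
   two runs meet the deadline at the same steps. *)
have xi'xi i l : (l < Num.truncn (t / tau i))%N -> xi' i l = xi i l.
  by move=> /xixi'.
elim: k => //= k ih; rewrite -!/(run _ _ _ _ _ k.+1).
case: ifP => [c|/negP c].
  by have e := eq_run tau0 xixi' c; rewrite -e c.
case: ifP => // c'.
by exfalso; apply: c; rewrite -(eq_run tau0 xi'xi c').
Qed.

(** A method sees the oracle only through its answers, so oracles for two targets that agree on the
    given samples cannot be told apart. *)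
Lemma eq_oracle_run (g g' : 'I_n -> 'rV[R]_d -> Sample -> 'rV[R]_d)
    (xi : 'I_n -> nat -> Sample) k :
  (forall i y l, g i y (xi i l) = g' i y (xi i l)) ->
  run tau x0 g z xi k = run tau x0 g' z xi k.
Proof.
move=> gg'; elim: k => //= k ->; rewrite /step.
by case: job => [[s y]|]//; case: ifP => // _; rewrite gg'.
Qed.

Lemma eq_oracle_run_within (g g' : 'I_n -> 'rV[R]_d -> Sample -> 'rV[R]_d)
    (xi : 'I_n -> nat -> Sample) t k :
  (forall i y l, g i y (xi i l) = g' i y (xi i l)) ->
  run_within tau x0 g z xi t k = run_within tau x0 g' z xi t k.
Proof.
move=> gg'; elim: k => //= k ->; rewrite -!/(run _ _ _ _ _ k.+1).
by rewrite (eq_oracle_run k.+1 gg').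
Qed.

End execution_ext.

(** * Measurability of runs *)

Section random_execution.
Variables (R : realType) (n d : nat) (dT : measure_display).
Variables (T : measurableType dT).

(* A state-valued random variable whose discrete part (which workers are busy,
   which workers returned a gradient and in which order) is deterministic. *)
Record shaped_state := ShapedState {
  shaped_clock : T -> R;
  shaped_job : 'I_n -> option ((T -> R) * (T -> 'rV[R]_d));
  shaped_returned : seq ('I_n * (T -> 'rV[R]_d))
}.

Definition state_at (s : shaped_state) (w : T) : state R n d :=
  State (shaped_clock s w)
        (fun i => omap (fun p => (p.1 w, p.2 w)) (shaped_job s i))
        [seq (p.1, p.2 w) | p <- shaped_returned s].

Definition measurable_shaped_state (s : shaped_state) : Prop :=
  [/\ measurable_fun [set: T] (shaped_clock s),
      (forall i p, shaped_job s i = Some p ->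
         measurable_fun [set: T] p.1 /\ random_vector p.2) &
      forall l, random_vector (nth (fun=> 0) (unzip2 (shaped_returned s)) l)].

(** Measurability of a method is given for a fixed sequence of workers only, so the space is covered
    by finitely many measurable pieces, possibly overlapping, on which that sequence is constant. *)
Definition piecewise_shaped (st : T -> state R n d) : Prop :=
  exists (I : finType) (S : I -> set T) (s : I -> shaped_state),
    [/\ forall e, measurable (S e), forall e, measurable_shaped_state (s e),
        (forall w, exists e, S e w) &
        forall e w, S e w -> st w = state_at (s e) w].

Lemma random_vector_tnth (G : seq ('I_n * (T -> 'rV[R]_d))) :
  (forall l, random_vector (nth (fun=> 0) (unzip2 G) l)) ->
  forall l : 'I_(size G), random_vector (tnth (in_tuple G) l).2.
Proof.
move=> mG l; have := mG l; set p := tnth _ _.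
rewrite (nth_map p) ?ltn_ord//.
by have -> : nth p G l = p by rewrite [in RHS]/p (tnth_nth p).
Qed.

Lemma measurable_le_fun (f h : T -> R) :
  measurable_fun [set: T] f -> measurable_fun [set: T] h ->
  measurable [set w | f w <= h w].
Proof.
move=> mf mh; have := measurable_fun_ler mf mh => /(_ measurableT [set true]).
by rewrite setTI; exact.
Qed.

Variables (tau : 'I_n -> R) (M : randomized_method R n d) (x0 : 'rV[R]_d).
Variables (dS : measure_display) (Sample : measurableType dS).
Variables (g : 'I_n -> 'rV[R]_d -> Sample -> 'rV[R]_d).
Variables (z : T -> seed M) (xi : 'I_n -> nat -> T -> Sample).
Hypothesis mg : forall i, jointly_measurable (g i).
Hypothesis mz : measurable_fun [set: T] z.
Hypothesis mxi : forall i l, measurable_fun [set: T] (xi i l).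

Lemma piecewise_shaped_step k st : piecewise_shaped st ->
  piecewise_shaped (fun w => step tau g (fun i l => xi i l w)
    (query x0 (z w) k (returned (st w))) (st w)).
Proof.
move=> [I [S [s [mS ms cov st_s]]]].
pose q e w := query x0 (z w) k [seq (p.1, p.2 w) | p <- shaped_returned (s e)].
pose time e w := Num.max (shaped_clock (s e) w) (req_time (q e w)).
pose finished e i : set T :=
  if shaped_job (s e) i is Some p then [set w | p.1 w + tau i <= time e w]
  else set0.
have mq e : random_request (q e).
  apply: query_measurable => //; apply: random_vector_tnth.
  by have [] := ms e.
have mtime e : measurable_fun [set: T] (time e).
  have [mc _ _] := ms e; have [mt _ _] := mq e.
  exact: measurable_maxr.
have mfin e i : measurable (finished e i).
  rewrite /finished; case E : shaped_job => [p|//].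
  have [_ /(_ _ _ E)[mp _] _] := ms e.
  by apply: measurable_le_fun => //; exact: measurable_funD.
(* Each piece is split by the contacted worker and by whether its job is finished. A piece for a
   finished job where there is no job is empty, and [s e] is a filler there. *)
exists (I * 'I_n * bool)%type.
exists (fun '(e, i, b) => S e `&` [set w | req_worker (q e w) = i] `&`
  if b then finished e i else ~` finished e i).
exists (fun '(e, i, b) =>
  if b then
    if shaped_job (s e) i is Some p then
      ShapedState (time e) [eta shaped_job (s e) with i |-> None]
        (rcons (shaped_returned (s e)) (i, fun w => g i (p.2 w)
          (xi i (count (fun p => p.1 == i) (shaped_returned (s e))) w)))
    else s e
  else ShapedState (time e)
    [eta shaped_job (s e) with i |-> Some (time e, fun w => req_point (q e w))]
    (shaped_returned (s e))).
split.
- move=> [[e i] b]; apply: measurableI.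
    by apply: measurableI => //; have [_ + _] := mq e; exact.
  by case: b => //; exact: measurableC.
- move=> [[e i] b]; have [mc mj mr] := ms e; have [_ _ mp] := mq e.
  case: b; last first.
    split => //= i' p.
    by case: eqP => [_ [<-]|_ /mj]//; split; [exact: mtime|exact: mp].
  case E : shaped_job => [p|//]; have [_ mp2] := mj _ _ E.
  split => //= [i' p'|l]; first by case: eqP => // _; exact: mj.
  rewrite /unzip2 map_rcons nth_rcons/=; case: ifP => // _.
  case: ifP => _; first exact: mg.
  move=> j; rewrite (_ : (fun w => _) = cst 0)//.
  by apply/funext => w; rewrite mxE.
- move=> w; have [e Se] := cov w.
  have [fw|fw] := pselect (finished e (req_worker (q e w)) w).
    by exists (e, req_worker (q e w), true).
  by exists (e, req_worker (q e w), false).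
- move=> [[e i] b] w [[Se qi]].
  rewrite (st_s _ _ Se) /step [returned _]/= -/(q e w) qi.
  rewrite [job _ _]/= [clock _]/= -/(time e w) /finished.
  case: b; case E : (shaped_job (s e) i) => [p|]//=; last first.
  - move=> _; rewrite /state_at/=; congr State.
    by apply/funext => i' /=; case: eqP.
  - move=> /negP/negbTE ->; rewrite /state_at/=; congr State.
    by apply/funext => i' /=; case: eqP.
  - move=> ->; rewrite /state_at/=; congr State.
      by apply/funext => i' /=; case: eqP.
    by rewrite map_rcons count_map.
Qed.

Lemma piecewise_shaped_run k :
  piecewise_shaped (fun w => run tau x0 g (z w) (fun i l => xi i l w) k).
Proof.
elim: k => [|k ih]; last exact: piecewise_shaped_step.
exists unit, (fun=> setT), (fun=> ShapedState (fun=> 0) (fun=> None) [::]).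
split => //.
move=> _; split => //= l; rewrite nth_nil => j.
by rewrite (_ : (fun w => _) = cst 0)//; apply/funext => w; rewrite mxE.
Qed.

Lemma piecewise_shaped_run_within t k :
  piecewise_shaped
    (fun w => run_within tau x0 g (z w) (fun i l => xi i l w) t k).
Proof.
elim: k => [|k [J [S' [s' [mS' ms' cov' st_s']]]]].
  exact: (piecewise_shaped_run 0).
have [I [S [s [mS ms cov st_s]]]] := piecewise_shaped_run k.+1.
pose early e : set T := [set w | shaped_clock (s e) w <= t].
have mearly e : measurable (early e).
  by apply: measurable_le_fun => //; have [] := ms e.
(* The boolean tells whether the longer run is still in time; otherwise the state comes from the
   shorter one. *)
exists (I * J * bool)%type, (fun '(e, e', b) => S e `&` S' e' `&`
  if b then early e else ~` early e), (fun '(e, e', b) =>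
  if b then s e else s' e').
split.
- move=> [[e e'] b]; apply: measurableI; first exact: measurableI.
  by case: b => //; exact: measurableC.
- by move=> [[e e'] []].
- move=> w; have [e Se] := cov w; have [e' Se'] := cov' w.
  have [c|c] := pselect (early e w).
    by exists (e, e', true).
  by exists (e, e', false).
- move=> [[e e'] b] w [[/st_s Se /st_s' Se']].
  rewrite [run_within _ _ _ _ _ _ _]/= -/(run _ _ _ _ _ k.+1) Se Se' /early.
  by case: b => /= [->//|/negP/negbTE ->].
Qed.

Lemma random_vector_produced_point t k :
  random_vector
    (fun w => produced_point tau x0 g (z w) (fun i l => xi i l w) t k).
Proof.
have [I [S [s [mS ms cov st_s]]]] := piecewise_shaped_run_within t k.
move=> j _ B mB; rewrite setTI.
pose y e w := output x0 (z w) [seq (p.1, p.2 w) | p <- shaped_returned (s e)].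
have my e : random_vector (y e).
  by apply: output_measurable => //; apply: random_vector_tnth; have [] := ms e.
rewrite (_ : _ @^-1` B =
  \bigcup_(e in [set: I]) (S e `&` (fun w => y e w 0 j) @^-1` B)).
  apply: fin_bigcup_measurable; first exact: finite_finset.
  move=> e _; apply: measurableI => //.
  by have := my e j measurableT B mB; rewrite setTI.
apply/seteqP; split => w /=.
  move=> Bw; have [e Se] := cov w; exists e => //; split => //.
  by move: Bw; rewrite /produced_point (st_s _ _ Se).
by move=> [e _ [Se]] /=; rewrite /produced_point (st_s _ _ Se).
Qed.

End random_execution.

(** * The hard instance *)

Lemma expectation_bernoulli (R : realType) (p : R) (h : bool -> R) :
  0 <= p <= 1 ->
  (bernoulli_prob p).-integrable [set: bool] (EFin \o h) /\
  'E_(bernoulli_prob p)[h]%E = (p * h true + (1 - p) * h false)%:E.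
Proof.
(* Adding [C] makes the integrand nonnegative; its contribution cancels at the end. *)
move=> p01; set C := `|h true| + `|h false|.
have hC b : 0 <= h b + C.
  rewrite /C -lerBlDl sub0r; have := ler_norm (- h b); rewrite normrN.
  by case: b => /le_trans; apply; rewrite ?lerDl ?lerDr.
have intC (c : R) : (bernoulli_prob p).-integrable [set: bool] (cst c%:E).
  exact: finite_measure_integrable_cst.
have inth : (bernoulli_prob p).-integrable [set: bool] (EFin \o h).
  apply: (@le_integrable _ _ _ _ _ measurableT _ (cst C%:E)) => //= b _.
  rewrite lee_fin [leRHS]ger0_norm ?addr_ge0//.
  by case: b; rewrite /C ?lerDl ?lerDr.
split => //.
have : (\int[bernoulli_prob p]_b (h b + C)%:E =
    p%:E * (h true + C)%:E + (unstable.onem p)%:E * (h false + C)%:E)%E.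
  by rewrite integral_bernoulli_prob// => b; rewrite lee_fin.
under eq_integral do rewrite EFinD.
rewrite integralD//=; last exact: intC.
rewrite integral_cst// [X in (C%:E * X)%E](_ : _ = 1%E) ?mule1; last first.
  exact: probability_setT.
rewrite unlock -[unstable.onem p]/(1 - p).
have /fineK <- : (\int[bernoulli_prob p]_b (h b)%:E)%E \is a fin_num.
  exact: integrable_fin_num inth.
by rewrite -!EFinM -!EFinD => -[e]; congr (_%:E); lra.
Qed.

Section hard_instance.
Variables (R : realType) (n m : nat) (s q : 'I_n -> R) (nu : R).
Local Notation d := #|{: 'I_n * 'I_m}|.
Local Notation blk j := (enum_val j).1.

Lemma sum_blocks (F : 'I_n -> 'I_m -> R) :
  \sum_(j < d) F (blk j) (enum_val j).2 = \sum_i \sum_c F i c.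
Proof.
rewrite pair_big -(@big_enum_val _ _ _ _ _ (fun p => F p.1 p.2))/=.
by apply: eq_big.
Qed.

Definition target (theta : {ffun 'I_n -> 'I_m}) (j : 'I_d) : R :=
  if (enum_val j).2 == theta (blk j) then s (blk j) else 0.

Definition block_weight (i : 'I_n) (j : 'I_d) : R :=
  if blk j == i then nu / 2 else 0.

Definition block_fun theta i : 'rV[R]_d -> R :=
  quadratic (block_weight i) (target theta).

Definition oracle theta i (x : 'rV[R]_d) (b : bool) : 'rV[R]_d :=
  \row_j if blk j == i then
           nu * x 0 j - (if b then nu * target theta j / q i else 0)
         else 0.

(** Each coordinate lies in the block of exactly one worker. With [nu] equal to [n] times [mu], the
    division by [n] leaves the weight [mu / 2]. *)
Lemma average_block_fun theta : (0 < n)%N ->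
  average (block_fun theta) = quadratic (fun=> nu / n%:R / 2) (target theta).
Proof.
move=> n0; apply/funext => x; rewrite /average /block_fun /quadratic.
rewrite exchange_big/= mulr_sumr; apply: eq_bigr => j _.
rewrite (bigD1 (blk j))//= big1 ?addr0; last first.
  by move=> i; rewrite /block_weight eq_sym => /negbTE ->; rewrite mul0r.
have n0' : n%:R != 0 :> R by rewrite pnatr_eq0 -lt0n.
by rewrite /block_weight eqxx; field.
Qed.

Lemma sum_sqr_target theta i :
  \sum_(j < d | blk j == i) target theta j ^+ 2 = s i ^+ 2.
Proof.
rewrite big_mkcond/= (sum_blocks (fun i' c => if i' == i then
  (if c == theta i' then s i' else 0) ^+ 2 else 0)).
rewrite (bigD1 i)//= [X in _ + X]big1 ?addr0; last first.
  by move=> i' /negbTE ->; rewrite big1.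
rewrite eqxx (bigD1 (theta i))//= eqxx big1 ?addr0// => c /negbTE ->.
by rewrite expr0n.
Qed.

Lemma grad_block_fun theta i x : grad (block_fun theta i) x =
  \row_j if blk j == i then nu * (x 0 j - target theta j) else 0.
Proof.
rewrite grad_quadratic; apply/rowP => j; rewrite !mxE /block_weight.
by case: ifP => _; [field|rewrite mulr0 mul0r].
Qed.

Hypothesis q01 : forall i, 0 < q i <= 1.

Lemma jointly_measurable_oracle theta i :
  jointly_measurable (oracle theta i).
Proof.
move=> dT T X b mX mb j.
rewrite (_ : (fun w => _) = fun w => if blk j == i then
  nu * X w 0 j - (if b w then nu * target theta j / q i else 0) else 0).
  2: by apply/funext => w; rewrite mxE.
case: (blk j == i) => //; apply: measurable_funB.
  by apply: measurable_funM => //; exact: mX.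
by apply: measurable_fun_ifT.
Qed.

Lemma unbiased_oracle theta i :
  unbiased (bernoulli_prob (q i)) (block_fun theta i) (oracle theta i).
Proof.
move=> x j; have /andP[q0 q1] := q01 i.
have [|] := @expectation_bernoulli R (q i) (fun b => oracle theta i x b 0 j).
  by rewrite (ltW q0).
move=> -> ->; split => //; rewrite grad_block_fun !mxE.
case: ifP => _; last by rewrite !mulr0 addr0.
congr (_%:E); have : q i != 0 by rewrite gt_eqF.
by move=> ?; field.
Qed.

Lemma variance_bounded_oracle theta i sigma2 :
  (nu * s i) ^+ 2 * (1 - q i) / q i <= sigma2 ->
  variance_bounded (bernoulli_prob (q i)) sigma2 (block_fun theta i)
    (oracle theta i).
Proof.
move=> h x; have /andP[q0 q1] := q01 i.
have [|_ ->] := @expectation_bernoulli R (q i)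
  (fun b => enorm (oracle theta i x b - grad (block_fun theta i) x) ^+ 2).
  by rewrite (ltW q0).
have q0' : q i != 0 by rewrite gt_eqF.
(* The terms in [x] cancel: the noise is the target on block [i] times [nu * (1 - b%:R / q i)], at
   every point. *)
have E b : enorm (oracle theta i x b - grad (block_fun theta i) x) ^+ 2 =
    (nu * (1 - b%:R / q i)) ^+ 2 * s i ^+ 2.
  rewrite sqr_enorm grad_block_fun -(sum_sqr_target theta i) mulr_sumr.
  rewrite [RHS]big_mkcond; apply: eq_bigr => j _; rewrite !mxE.
  case: ifP => _; last by rewrite subr0 expr0n.
  by move: (target theta j) => T; case: b => /=; [field|rewrite mul0r; ring].
rewrite !E lee_fin; apply: le_trans h; rewrite le_eqVlt; apply/orP; left.
by apply/eqP => /=; field.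
Qed.

(** On a false bit the answer does not involve the target, so [theta i] is invisible as long as
    worker [i] draws only false bits. *)
Lemma eq_oracle (theta theta' : {ffun 'I_n -> 'I_m}) i
    (b : 'I_n -> nat -> bool) :
  (forall i', i' != i -> theta i' = theta' i') -> (forall l, ~~ b i l) ->
  forall i' y l, oracle theta i' y (b i' l) = oracle theta' i' y (b i' l).
Proof.
move=> tt' bi i' y l; apply/rowP => j; rewrite !mxE; case: eqP => // <-.
case E : (b (blk j) l) => //; rewrite /target tt'//.
by apply: contraTneq E => ->.
Qed.

Definition block_error theta i (y : 'rV[R]_d) : R :=
  \sum_(j < d | blk j == i) (y 0 j - target theta j) ^+ 2.

Lemma sqr_enorm_blocks theta y :
  enorm (y - \row_j target theta j) ^+ 2 = \sum_i block_error theta i y.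
Proof.
rewrite sqr_enorm (partition_big (fun j : 'I_d => blk j) predT)//=.
by apply: eq_bigr => i _; apply: eq_bigr => j _; rewrite !mxE.
Qed.

Lemma block_error_ge0 theta i y : 0 <= block_error theta i y.
Proof. by apply: sumr_ge0 => j _; exact: sqr_ge0. Qed.

Lemma measurable_block_error theta i (dT : measure_display)
    (T : measurableType dT) (Y : T -> 'rV[R]_d) :
  random_vector Y ->
  measurable_fun [set: T] (fun w => block_error theta i (Y w)).
Proof.
move=> mY; under eq_fun do rewrite /block_error big_mkcond.
apply: measurable_sum => j; case: (blk j == i) => //.
by apply: measurable_funX; apply: measurable_funB => //; exact: mY.
Qed.

(* Distinct targets of the same block are at distance sqrt 2 * s i, so the balls
   of radius s i / sqrt 2 around them are disjoint. *)
Lemma block_error_inj (theta theta' : {ffun 'I_n -> 'I_m}) i y :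
  block_error theta i y < s i ^+ 2 / 2 ->
  block_error theta' i y < s i ^+ 2 / 2 -> theta i = theta' i.
Proof.
move=> h h'; apply/eqP/negPn/negP => tt'.
pose u : 'I_d := enum_rank (i, theta i).
pose v : 'I_d := enum_rank (i, theta' i).
have uv : u != v by rewrite (inj_eq enum_rank_inj) xpair_eqE eqxx.
have two th : (y 0 u - target th u) ^+ 2 + (y 0 v - target th v) ^+ 2 <=
    block_error th i y.
  rewrite /block_error (bigD1 u)/= ?enum_rankK//.
  rewrite (bigD1 v)/= ?enum_rankK ?eqxx 1?eq_sym//.
  by rewrite addrA lerDl sumr_ge0// => j _; exact: sqr_ge0.
have := le_lt_trans (two theta) h; have := le_lt_trans (two theta') h'.
rewrite /target !enum_rankK/= !eqxx (negbTE tt') eq_sym (negbTE tt').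
(* The two errors, restricted to [u] and [v], add up to [s i ^+ 2] plus half the sum of these
   squares, yet should be less than [s i ^+ 2]. *)
have := sqr_ge0 (2 * y 0 u - s i); have := sqr_ge0 (2 * y 0 v - s i).
rewrite !expr2; lra.
Qed.

End hard_instance.

(** * Weighted sums of events *)

Section weighted_events.
Variables (R : realType) (dT : measure_display) (T : measurableType dT).
Variables (P : probability T R) (K : finType) (c : K -> R) (A : K -> set T).
Hypotheses (c0 : forall k, 0 <= c k) (mA : forall k, measurable (A k)).

Let measurable_weighted :
  measurable_fun [set: T] (fun w => \sum_k c k * \1_(A k) w).
Proof.
by apply: measurable_sum => k; apply: measurable_funM => //;
  exact: measurable_indic.
Qed.

Let weighted_ge0 w : 0 <= \sum_k c k * \1_(A k) w.
Proof. by apply: sumr_ge0 => k _; rewrite mulr_ge0// indicE. Qed.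

Let expectation_weighted : 'E_P[(fun w => (\sum_k c k * \1_(A k) w)%R)]%E =
  (\sum_k c k * fine (P (A k)))%:E.
Proof.
rewrite unlock; under eq_integral do rewrite -sumEFin.
rewrite ge0_integral_sum//=; last 2 first.
- by move=> k; apply/measurable_EFinP; apply: measurable_funM.
- by move=> k w _; rewrite lee_fin mulr_ge0// indicE.
rewrite -sumEFin; apply: eq_bigr => k _.
under eq_integral do rewrite EFinM.
rewrite ge0_integralZl//=; last 2 first.
- by apply/measurable_EFinP; exact: measurable_indic.
- by rewrite lee_fin.
by rewrite integral_indic// setIT EFinM fineK// fin_num_measure.
Qed.

(** Linearity of expectation, however the events depend on each other. *)
Lemma weighted_probability_le (X : T -> R) :
  measurable_fun [set: T] X -> (forall w, \sum_k c k * \1_(A k) w <= X w) ->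
  ((\sum_k c k * fine (P (A k)))%:E <= 'E_P[X])%E.
Proof.
move=> mX AX; rewrite -expectation_weighted; apply: expectation_le => //.
- by move=> w; exact: le_trans (AX w).
- exact: aeW.
Qed.

Lemma weighted_probability_ge (C : R) :
  (forall w, \sum_k c k * \1_(A k) w <= C) ->
  \sum_k c k * fine (P (A k)) <= C.
Proof.
move=> AC; rewrite -lee_fin -expectation_weighted.
rewrite -[leRHS](expectation_cst P); apply: expectation_le => //.
- by move=> w; exact: le_trans (AC w).
- exact: aeW.
Qed.

End weighted_events.

(** An averaging argument: for uniform [x] and any outcome, each [H x i] occurs with frequency at
    most [c / #|J|], so the probabilities summed over [i] average to at most [c]. Hence they cannot
    exceed [c] for every [x]. *)
Lemma exists_small_events (R : realType) (dT : measure_display)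
    (T : measurableType dT) (P : probability T R) (I J : finType)
    (H : I -> J -> set T) (c : R) :
  (0 < #|I|)%N ->
  (forall x i, measurable (H x i)) ->
  (forall w i,
    (#|[pred x | `[<H x i w>]]|)%:R * #|J|%:R <= c * #|I|%:R) ->
  exists x, forall i, fine (P (H x i)) <= c.
Proof.
move=> I0 mH cH; apply: contrapT => noH.
have {}noH x : exists i, c < fine (P (H x i)).
  apply: contrapT => nox; apply: noH; exists x => i.
  by rewrite leNgt; apply/negP => ?; apply: nox; exists i.
have /card_gt0P[x0 _] := I0; have [i0 _] := noH x0.
have J0 : (0 < #|J|)%N by apply/card_gt0P; exists i0.
have : \sum_(p : I * J) 1 * fine (P (H p.1 p.2)) <= c * #|I|%:R.
  apply: weighted_probability_ge => // w.
  under eq_bigr do rewrite mul1r.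
  rewrite -(pair_bigA _ (fun x i => \1_(H x i) w))/= exchange_big/=.
  rewrite -(@ler_pM2r _ #|J|%:R) ?ltr0n// mulr_suml.
  apply: (@le_trans _ _ (\sum_(i : J) c * #|I|%:R)).
    apply: ler_sum => i _; apply: le_trans (cH w i).
    rewrite ler_wpM2r// -sum1_card natr_sum [in leRHS]big_mkcond/=.
    apply: ler_sum => x _; rewrite inE indicE.
    by case: asboolP => h; [rewrite mem_set|rewrite memNset].
  by rewrite sumr_const -[leLHS]mulr_natr.
apply/negP; rewrite -real_ltNge ?num_real//; under eq_bigr do rewrite mul1r.
rewrite -(pair_bigA _ (fun x i => fine (P (H x i))))/=.
rewrite mulr_natr -sumr_const.
rewrite (bigD1 x0)//= [X in _ < X](bigD1 x0)//=.
have big x : c < \sum_i fine (P (H x i)).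
  have [i ci] := noH x; apply: lt_le_trans ci _.
  by rewrite (bigD1 i)//= lerDl sumr_ge0// => j _; exact: fine_ge0.
by apply: ltr_leD => //; apply: ler_sum => x _; exact: ltW.
Qed.

(** * Guessing the minimizer *)

Section guessing.
Variables (R : realType) (n m : nat) (s q : 'I_n -> R) (nu : R).
Variables (tau : 'I_n -> R) (t : R).
Local Notation d := #|{: 'I_n * 'I_m}|.
Variable M : randomized_method R n d.
Local Notation N := (\sum_(i < n) Num.truncn (t / tau i))%N.
Local Notation bit_table := {ffun 'I_n * 'I_N -> bool}.

(** Silent beyond the table, whose width [N] covers every sample a worker can use in time. *)
Definition bit_stream (b : bit_table) (i : 'I_n) (l : nat) : bool :=
  if insub l is Some l' then b (i, l') else false.

Lemma bit_stream_ffun (xi : 'I_n -> nat -> bool) i l :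
  (l < N)%N -> bit_stream [ffun p : 'I_n * 'I_N => xi p.1 p.2] i l = xi i l.
Proof. by move=> lN; rewrite /bit_stream insubT ffunE. Qed.

(* Quantifying over all bit tables, instead of a random one, makes this event
   depend on the seed only. *)
Definition guessed (theta : {ffun 'I_n -> 'I_m}) (i : 'I_n) (z : seed M) :
    Prop :=
  exists (b : bit_table) (k : nat), (forall l, ~~ bit_stream b i l) /\
    block_error s theta i
      (produced_point tau 0 (oracle s q nu theta) z (bit_stream b) t k) <
    s i ^+ 2 / 2.

(** There are finitely many tables and countably many [k], and with frozen bits a produced point is
    a measurable function of the seed. *)
Lemma measurable_guessed theta i : measurable (guessed theta i).
Proof.
pose G (b : bit_table) k : set (seed M) :=
  if [forall l, ~~ b (i, l)] then
    [set z | block_error s theta i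
      (produced_point tau 0 (oracle s q nu theta) z (bit_stream b) t k) <
      s i ^+ 2 / 2]
  else set0.
rewrite (_ : guessed theta i = \bigcup_(b in [set: bit_table]) \bigcup_k G b k).
  apply: fin_bigcup_measurable; first exact: finite_finset.
  move=> b _; apply: bigcupT_measurable => k; rewrite /G; case: ifP => // _.
  have my : random_vector (fun z : seed M =>
      produced_point tau 0 (oracle s q nu theta) z (bit_stream b) t k).
    apply: (@random_vector_produced_point R n d _ (seed M) tau M 0 _ bool
      (oracle s q nu theta) id (fun i l _ => bit_stream b i l)) => //.
    exact: jointly_measurable_oracle.
  have := measurable_fun_ltr (measurable_block_error s theta i my)
    (@measurable_cst _ _ _ _ setT (s i ^+ 2 / 2)).
  move=> /(_ measurableT [set true]).
  by rewrite setTI; exact.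
apply/seteqP; split => [z [b [k [bi e]]]|z [b _ [k _]]].
  exists b => //; exists k => //; rewrite /G ifT//.
  apply/forallP => l; have := bi l.
  rewrite /bit_stream insubT// => ?.
  by rewrite (_ : Sub _ _ = l)//; apply: val_inj.
rewrite /G; case: ifP => // /forallP bi e; exists b, k; split => //.
by move=> l; rewrite /bit_stream; case: insubP.
Qed.

Hypothesis tau_gt0 : forall i, 0 < tau i.

(* With worker i never revealing anything, the run does not depend on theta i,
   and its successive histories are prefixes of one another; so all correct
   guesses come from at most one output for each bit table and history size. *)
Lemma card_guessed z i :
  (#|[pred theta | `[<guessed theta i z>]]| * m <=
   #|{ffun 'I_n -> 'I_m}| * (2 ^ (n * N) * N.+1))%N.
Proof.
pose S := [set theta | `[<guessed theta i z>]]%SET.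
have -> : #|[pred theta | `[<guessed theta i z>]]| = #|S|.
  by apply: eq_card => theta; rewrite !inE.
(* A witness is chosen for every [theta], with a dummy one outside [S]. *)
have wit (theta : {ffun 'I_n -> 'I_m}) : exists bk : bit_table * nat,
    guessed theta i z -> (forall l, ~~ bit_stream bk.1 i l) /\
    block_error s theta i (produced_point tau 0 (oracle s q nu theta) z
      (bit_stream bk.1) t bk.2) < s i ^+ 2 / 2.
  have [[b [k h]]|h] := pselect (guessed theta i z); first by exists (b, k).
  by exists ([ffun=> false], 0%N).
have {wit}[W WP] := choice wit.
pose history_at theta := returned (run_within tau 0 (oracle s q nu theta) z
  (bit_stream (W theta).1) t (W theta).2).
pose set_i (theta : {ffun 'I_n -> 'I_m}) c :=
  [ffun i' => if i' == i then c else theta i'].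
(* [phi] overwrites [theta i] by a free value [c]; its injectivity says that the table and the
   history length suffice to recover [theta i]. *)
pose phi (p : {ffun 'I_n -> 'I_m} * 'I_m) :
    {ffun 'I_n -> 'I_m} * (bit_table * 'I_N.+1) :=
  (set_i p.1 p.2, ((W p.1).1, inord (size (history_at p.1)))).
have phi_inj : {in finset.setX S [set: 'I_m]%SET &, injective phi}.
  move=> [theta c] [theta' c'] /=; rewrite !inE !andbT.
  move=> /asboolP/WP[bi e] /asboolP/WP[bi' e'] [tt' bb' hh'].
  have cc' : c = c' by move/ffunP : tt' => /(_ i); rewrite !ffunE eqxx.
  have off i' : i' != i -> theta i' = theta' i'.
    by move=> /negbTE ii'; move/ffunP : tt' => /(_ i'); rewrite !ffunE ii'.
  have same k : run_within tau 0 (oracle s q nu theta') z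
      (bit_stream (W theta).1) t k =
      run_within tau 0 (oracle s q nu theta) z (bit_stream (W theta).1) t k.
    apply: eq_oracle_run_within => i' y l; apply/esym.
    exact: (eq_oracle _ _ _ off bi).
  (* Histories have length at most [N], so [inord] loses nothing, and both are taken from one and
     the same run. *)
  have hist : history_at theta = history_at theta'.
    move/(congr1 (@nat_of_ord _)): hh'.
    rewrite !inordK ?ltnS ?le_size_returned_run_within//.
    rewrite /history_at -bb' same; exact: eq_returned_run_within.
  congr (_, _) => //; apply/ffunP => i'.
  have [->|] := eqVneq i' i; last exact: off.
  (* The common output is close to the targets of both [theta] and [theta'] on block [i]. *)
  apply: block_error_inj e _; move: e'.
  by rewrite /produced_point -!/(history_at _) hist.
rewrite -[X in (_ * X <= _)%N]card_ord -[X in (_ * X <= _)%N]cardsT -cardsX.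
rewrite -(card_in_imset phi_inj); apply: leq_trans (max_card _) _.
rewrite !card_prod card_ord [X in (_ * (X * _))%N]card_ffun.
by rewrite card_prod !card_ord card_bool.
Qed.

End guessing.

(** * The lower bound *)

Section independence.
Variables (R : realType) (n : nat) (dO dZ dS : measure_display).
Variables (Omega : measurableType dO) (Z : measurableType dZ).
Variables (Sample : measurableType dS) (P : probability Omega R).
Variables (Q : probability Z R) (D : 'I_n -> probability Sample R).
Variables (zeta : Omega -> Z) (xi : 'I_n -> nat -> Omega -> Sample).
Hypothesis ind : independent_with_laws P Q D zeta xi.

Lemma law_seed A : measurable A -> P [set w | A (zeta w)] = Q A.
Proof.
have [_ _ law] := ind => mA.
(* With [K = 0] no sample is constrained and all the products are empty. *)
have := law 0%N A (fun _ _ => setT) mA (fun _ _ => measurableT).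
rewrite big1 ?mule1 => [<-|i _]; last by rewrite big_ord0.
congr (P _); apply/seteqP; split => w /=; last by case.
by split => // i [].
Qed.

Lemma law_sample i l B : measurable B -> P [set w | B (xi i l w)] = D i B.
Proof.
have [_ _ law] := ind => mB.
pose C i' l' := if (i' == i) && (l' == l) then B else setT.
have mC i' l' : measurable (C i' l') by rewrite /C; case: ifP.
have := law l.+1 setT C measurableT mC.
rewrite probability_setT mul1e (bigD1 i)//= [X in (_ * X)%E]big1 ?mule1.
  2: move=> i' ii'; rewrite big1// => k _.
  2: by rewrite /C (negbTE ii') probability_setT.
rewrite (bigD1 ord_max)//= [X in (_ * X)%E]big1 ?mule1.
  2: move=> k kl; rewrite /C eqxx/= ifF ?probability_setT//.
  2: by apply: contraNF kl => /eqP e; apply/eqP/val_inj.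
rewrite {2}/C !eqxx/= => <-; congr (P _); apply/seteqP; split => w /=.
  move=> Bw; split => // i' k; rewrite /C.
  by case: ifP => // /andP[/eqP -> /eqP ->].
by move=> [_ /(_ i ord_max)]; rewrite /C !eqxx.
Qed.

End independence.

(** A union bound over the [K] bits and [H]. *)
Lemma probability_silent_outside (R : realType) (dO : measure_display)
    (Omega : measurableType dO) (P : probability Omega R)
    (xi : nat -> Omega -> bool) (K : nat) (H : set Omega) (q : R) :
  measurable H -> (forall l, measurable_fun [set: Omega] (xi l)) ->
  (forall l, P [set w | xi l w] = q%:E) ->
  let A := [set w | forall l, (l < K)%N -> ~~ xi l w] `\` H in
  measurable A /\ 1 - (K%:R * q + fine (P H)) <= fine (P A).
Proof.
move=> mH mxi Pxi A.
have mX l : measurable [set w | xi l w].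
  have := mxi l measurableT [set true] => /(_ I); rewrite setTI.
  by congr measurable; apply/seteqP; split => w.
pose U := \big[setU/set0]_(l < K) [set w | xi l w].
have mU : measurable U by exact: bigsetU_measurable.
have AE : A = ~` (U `|` H).
  rewrite setCU /A setDE; congr (_ `&` _).
  rewrite /U -(bigcup_mkord K (fun l => [set w | xi l w])) setC_bigcup.
  apply/seteqP; split => w /= h l.
    by move=> /h /negP.
  by move=> /h /negP.
have mUH : measurable (U `|` H) by exact: measurableU.
split; first by rewrite AE; exact: measurableC.
rewrite AE probability_setC// fineB ?fin_num_measure//= lerD2l lerN2.
have : (P (U `|` H) <= (K%:R * q + fine (P H))%:E)%E.
  apply: (@le_trans _ _ (P U + P H)%E); first exact: measureU2.
  rewrite EFinD fineK ?fin_num_measure// leeD2r//.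
  apply: (@le_trans _ _ (\sum_(l < K) P [set w | xi l w])%E).
    exact: (Boole_inequality P (A := fun l => [set w | xi l w])).
  under eq_bigr do rewrite Pxi.
  by rewrite sumEFin sumr_const card_ord mulr_natl.
by rewrite -{1}(@fineK _ (P (U `|` H))) ?fin_num_measure// lee_fin.
Qed.

Section lower_bound.
Variables (R : realType) (n m : nat) (s q : 'I_n -> R) (nu : R).
Variables (tau : 'I_n -> R) (t : R).
Local Notation d := #|{: 'I_n * 'I_m}|.
Variable M : randomized_method R n d.
Variable theta : {ffun 'I_n -> 'I_m}.
Local Notation N := (\sum_(i < n) Num.truncn (t / tau i))%N.
Hypothesis tau_gt0 : forall i, 0 < tau i.

Lemma block_error_ge (z : seed M) (xi : 'I_n -> nat -> bool) i k :
  (forall l, (l < Num.truncn (t / tau i))%N -> ~~ xi i l) ->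
  ~ guessed s q nu tau t theta i z ->
  s i ^+ 2 / 2 <= block_error s theta i
    (produced_point tau 0 (oracle s q nu theta) z xi t k).
Proof.
move=> silent ng; rewrite leNgt; apply/negP => e; apply: ng.
(* Bits beyond the time budget are cleared. This does not change the point and makes worker [i]
   silent forever, as [guessed] demands. *)
pose xi' i l := (l < Num.truncn (t / tau i))%N && xi i l.
exists [ffun p : 'I_n * 'I_N => xi' p.1 p.2], k; split.
  move=> l; have [lN|Nl] := ltnP l N; last first.
    by rewrite /bit_stream insubF// ltnNge Nl.
  rewrite bit_stream_ffun//; apply/negP => /andP[/silent].
  by move=> /negP.
rewrite -(@eq_produced_point _ _ _ _ _ _ _ _ _ xi)// => i' l lK.
rewrite bit_stream_ffun /xi' ?lK//.
by apply: leq_trans lK _; rewrite (bigD1 i')//= leq_addr.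
Qed.

Variables (dO : measure_display) (Omega : measurableType dO).
Variables (P : probability Omega R) (zeta : Omega -> seed M).
Variables (xi : 'I_n -> nat -> Omega -> bool).
Hypothesis ind : independent_with_laws P (seed_law M)
  (fun i => bernoulli_prob (q i)) zeta xi.
Hypothesis q01 : forall i, 0 < q i <= 1.

Lemma expected_error_ge (kappa delta : R) k :
  (forall i, (Num.truncn (t / tau i))%:R * q i <= kappa) ->
  (forall i, fine (seed_law M (guessed s q nu tau t theta i)) <= delta) ->
  ((\sum_i s i ^+ 2 / 2 * (1 - (kappa + delta)))%:E <=
   'E_P[(fun w => enorm (produced_point tau 0 (oracle s q nu theta) (zeta w)
     (fun i l => xi i l w) t k - \row_j target s theta j) ^+ 2)%R])%E.
Proof.
move=> Kq small; have [mzeta mxi _] := ind.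
pose H i := [set w | guessed s q nu tau t theta i (zeta w)].
(* On [A i] worker [i] reveals nothing in time and [theta i] is not guessed, so block [i] costs at
   least [s i ^+ 2 / 2]. *)
pose A i := [set w | forall l, (l < Num.truncn (t / tau i))%N -> ~~ xi i l w]
  `\` H i.
have mH i : measurable (H i).
  have := mzeta measurableT _ (measurable_guessed s q nu tau t M theta i).
  by rewrite setTI.
have Pxi i l : P [set w | xi i l w] = (q i)%:E.
  have /= := law_sample ind i l (B := [set true]) I.
  rewrite bernoulli_probE; last by have /andP[/ltW q0 q1] := q01 i; apply/andP.
  rewrite !diracE mem_set// memNset// mule1 mule0 adde0 => <-.
  by congr (P _); apply/seteqP; split.
have PA i := probability_silent_outside (Num.truncn (t / tau i)) (mH i)
  (mxi i) (Pxi i).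
have half i : 0 <= s i ^+ 2 / 2 by rewrite divr_ge0 ?sqr_ge0.
pose y w := produced_point tau 0 (oracle s q nu theta) (zeta w)
  (fun i l => xi i l w) t k.
have my : random_vector y.
  apply: random_vector_produced_point => //.
  exact: jointly_measurable_oracle.
apply: (@le_trans _ _ (\sum_i s i ^+ 2 / 2 * fine (P (A i)))%:E).
  rewrite lee_fin; apply: ler_sum => i _; apply: ler_wpM2l => //.
  have [_] := PA i; apply: le_trans; rewrite lerD2l lerN2 lerD//.
  by rewrite /H (law_seed ind)//; exact: measurable_guessed.
under [in leRHS]eq_fun do rewrite sqr_enorm_blocks.
apply: weighted_probability_le => //.
- by move=> i; have [] := PA i.
- by apply: measurable_sum => i; exact: measurable_block_error.
- move=> w; apply: ler_sum => i _; rewrite indicE.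
  have [wA|_] := boolP (w \in A i); last by rewrite mulr0 block_error_ge0.
  move: wA; rewrite inE mulr1 => -[silent ng].
  exact: block_error_ge.
Qed.

End lower_bound.

Theorem theorem3p6 (R : realType) :
  exists c0 : R, 0 < c0 /\
  forall (n : nat) (tau : 'I_n -> R),
    (2 <= n)%N ->
    (forall i, 0 < tau i) ->
    (forall i j : 'I_n, (i <= j)%N -> tau i <= tau j) ->
  forall (M : forall d : nat, randomized_method R n d)
    (eps Lmax rad mu sigma2 : R),
    0 < eps -> 0 < Lmax -> 0 < rad -> 0 < mu -> 0 < sigma2 ->
    mu < Lmax / (2 * n%:R) -> eps < 1 / 100 -> 10 < rad ->
  forall t : R,
    t <= c0 * (n%:R^-1 * \sum_(i < n) tau i)
         * (sigma2 / (eps * n%:R * mu ^+ 2)) ->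
  exists (d : nat) (f : 'I_n -> 'rV[R]_d -> R)
    (dS : measure_display) (Sample : measurableType dS)
    (D : 'I_n -> probability Sample R)
    (g : 'I_n -> 'rV[R]_d -> Sample -> 'rV[R]_d)
    (x0 : 'rV[R]_d) (proj : 'rV[R]_d -> 'rV[R]_d),
    (forall x, closest_minimizer (average f) x (proj x)) /\
    enorm (x0 - proj x0) <= rad /\
    (forall i, differentiable_everywhere (f i) /\ smooth Lmax (f i) /\
               convex_everywhere (f i)) /\
    (exists x, minimizer (average f) x) /\
    (forall x, minimizer (average f) x -> forall i, minimizer (f i) x) /\
    (forall i, PL mu (f i)) /\
    smooth Lmax (average f) /\ PL mu (average f) /\
    (forall i, jointly_measurable (g i) /\ unbiased (D i) (f i) (g i) /\
               variance_bounded (D i) sigma2 (f i) (g i)) /\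
    (forall (dO : measure_display) (Omega : measurableType dO)
       (P : probability Omega R) (zeta : Omega -> seed (M d))
       (xi : 'I_n -> nat -> Omega -> Sample),
       independent_with_laws P (seed_law (M d)) D zeta xi ->
       forall k : nat,
         let xbar w :=
           produced_point tau x0 g (zeta w) (fun i l => xi i l w) t k in
         (eps%:E < 'E_P[(fun w => enorm (xbar w - proj (xbar w)) ^+ 2)%R])%E).
Proof.
(* The expected number of revelations by one worker will be at most four times this constant, that
   is 1/4. *)
exists (1 / 16); split; first by lra.
move=> n tau n2 tau0 _ M eps Lmax rad mu sigma2 eps0 L0 _ mu0 sigma0 muL eps1.
move=> rad10 t tle.
have n0 : (0 < n)%N by exact: leq_trans n2.
have nR : (0 : R) < n%:R by rewrite ltr0n.
set S := \sum_(i < n) tau i in tle.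
have S0 : 0 < S.
  rewrite /S (bigD1 (Ordinal n0))//= ltr_wpDr// sumr_ge0// => i _.
  exact: ltW.
set nu := n%:R * mu.
have nu0 : 0 < nu by rewrite mulr_gt0.
have nuL : 2 * nu < Lmax.
  by move: muL; rewrite ltr_pdivlMr ?mulr_gt0// /nu; lra.
have mu_nu : mu <= nu by rewrite ler_peMl ?ler1n// ltW.
(* Proportionality to [tau i] gives one bound on [q i / tau i] for all workers; the factor 4 absorbs
   the later losses 1/2 and 5/8. *)
pose s i := Num.sqrt (4 * eps * (tau i / S)).
have s2_gt0 i : 0 < 4 * eps * (tau i / S).
  by apply: mulr_gt0; [exact: mulr_gt0|exact: divr_gt0].
have s2 i : s i ^+ 2 = 4 * eps * (tau i / S) by rewrite sqr_sqrtr// ltW.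
have s0 i : 0 < s i by rewrite sqrtr_gt0.
have sum_s2 : \sum_i s i ^+ 2 = 4 * eps.
  under eq_bigr do rewrite s2.
  by rewrite -mulr_sumr -mulr_suml divff ?mulr1// gt_eqF.
(* If the minimum is 1 the oracle is exact; otherwise its variance is [sigma2 - (nu * s i) ^+ 2]. *)
pose q i := Num.min 1 ((nu * s i) ^+ 2 / sigma2).
have nus0 i : 0 < (nu * s i) ^+ 2 by rewrite exprn_gt0// mulr_gt0.
have q01 i : 0 < q i <= 1.
  by rewrite lt_min ltr01 divr_gt0//= ge_min lexx.
have qvar i : (nu * s i) ^+ 2 * (1 - q i) / q i <= sigma2.
  rewrite /q; have [le1|lt1] := leP 1 ((nu * s i) ^+ 2 / sigma2).
    by rewrite subrr mulr0 mul0r; exact: ltW.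
  set a := (nu * s i) ^+ 2 in nus0 *.
  have a0 : 0 < a := nus0 i.
  have -> : a * (1 - a / sigma2) / (a / sigma2) = sigma2 - a.
    by field; rewrite !gt_eqF.
  by rewrite gerBl ltW.
have Kq i : (Num.truncn (t / tau i))%:R * q i <= 1 / 4.
  (* A negative [t] is allowed, and the truncation is then 0. *)
  have [tneg|t0] := ltP t 0.
    rewrite (_ : Num.truncn _ = 0%N) ?mul0r; first by lra.
    apply/truncn0Pn; rewrite -ltNge (@lt_trans _ _ 0)//.
    by rewrite pmulr_llt0// invr_gt0.
  apply: (@le_trans _ _ (t / tau i * ((nu * s i) ^+ 2 / sigma2))).
    apply: ler_pM => //; first by have /andP[/ltW] := q01 i.
      by rewrite truncn_le// divr_ge0// ltW.
    by rewrite ge_min lexx orbT.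
  rewrite exprMn s2.
  have -> : t / tau i * (nu ^+ 2 * (4 * eps * (tau i / S)) / sigma2) =
      t * (4 * eps * nu ^+ 2 / (S * sigma2)).
    by field; rewrite !gt_eqF.
  apply: (le_trans (ler_wpM2r _ tle)).
    by rewrite divr_ge0 ?mulr_ge0 ?sqr_ge0// ltW.
  rewrite le_eqVlt; apply/orP; left; apply/eqP; rewrite /nu.
  by field; rewrite !gt_eqF.
pose N := (\sum_(i < n) Num.truncn (t / tau i))%N.
pose B := (2 ^ (n * N) * N.+1)%N.
have B0 : (0 < B)%N by rewrite /B muln_gt0 expn_gt0.
(* By [card_guessed] a fraction at most [B / m] of the targets is guessed on a given block; this is
   [1 / (8 * n)], and summing over the [n] blocks gives 1/8. *)
pose m := (8 * n * B)%N.
have m0 : (0 < m)%N by rewrite /m muln_gt0 muln_gt0 n0 B0.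
pose d := #|{: 'I_n * 'I_m}|.
have [theta small] : exists theta : {ffun 'I_n -> 'I_m}, forall i,
    fine (seed_law (M d) (guessed s q nu tau t theta i)) <= 1 / 8.
  apply: exists_small_events.
  - by rewrite card_ffun !card_ord expn_gt0 m0.
  - by move=> theta i; exact: measurable_guessed.
  - move=> z i; have := @card_guessed R n m s q nu tau t (M d) tau0 z i.
    rewrite -/N -/B card_ord.
    move: #|_| #|{ffun _ -> _}| => I C h.
    have {}h : (I * (8 * n) * B <= C * B)%N by rewrite -mulnA.
    rewrite leq_pmul2r// in h.
    have : (I * (8 * n))%:R <= C%:R :> R by rewrite ler_nat.
    by rewrite !natrM; lra.
pose f := @block_fun R n m s nu theta.
have favg : average f = quadratic (fun=> mu / 2) (target s theta).
  rewrite average_block_fun// /nu; congr (quadratic _ _); apply/funext => j.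
  by field; rewrite gt_eqF.
pose p : 'rV[R]_d := \row_j target s theta j.
have pE j : p 0 j = target s theta j by rewrite mxE.
have w0 i j : 0 <= @block_weight R n m nu i j.
  by rewrite /block_weight; case: ifP => // _; rewrite divr_ge0// ltW.
have min_avg x : minimizer (average f) x -> x = p.
  rewrite favg; apply: minimizer_quadratic_uniq => j.
  by rewrite divr_gt0.
have avg_min : minimizer (average f) p.
  by rewrite favg; apply: minimizer_quadratic => // j; rewrite divr_ge0// ltW.
exists d, f, _, bool, (fun i => bernoulli_prob (q i)), (oracle s q nu theta), 0,
  (fun=> p).
split; first by move=> x; split => // r /min_avg ->.
split.
  (* The squared distance from 0 to [p] is [4 * eps], below 1/25, while [rad] exceeds 10. *)
  rewrite -(@ler_pXn2r _ 2)// ?nnegrE ?enorm_ge0//; last by lra.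
  rewrite sqr_enorm_blocks.
  rewrite (eq_bigr (fun i => s i ^+ 2)) => [|i _]; last first.
    rewrite -(sum_sqr_target s theta); apply: eq_bigr => j _.
    by rewrite mxE sub0r sqrrN.
  by rewrite sum_s2; nra.
split.
  move=> i; split; first exact: differentiable_quadratic.
  split; last exact: convex_quadratic.
  apply: smooth_quadratic => j; rewrite mulr_ge0//=.
  by rewrite /block_weight; case: ifP => _; lra.
split; first by exists p.
split.
  by move=> x /min_avg -> i; exact: minimizer_quadratic.
split.
  move=> i; apply: PL_quadratic => // j.
  by rewrite /block_weight; case: ifP => _; [right; lra|left].
split.
  rewrite favg; apply: smooth_quadratic => j.
  by apply/andP; split; lra.
split.
  rewrite favg; apply: PL_quadratic => j; [lra|right; lra].
split.
  move=> i; split; first exact: jointly_measurable_oracle.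
  split; first exact: unbiased_oracle.
  by apply: variance_bounded_oracle.
move=> dO Omega P zeta xi ind k; cbv zeta.
apply: lt_le_trans (expected_error_ge tau0 ind q01 k Kq small).
(* The bound equals [4 * eps / 2 * (1 - (1 / 4 + 1 / 8))], that is [5 / 4 * eps]. *)
rewrite lte_fin -mulr_suml -mulr_suml sum_s2; lra.
Qed.
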